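(* A local minimizer of problem (P) at instant $t\ge0$ is an asymptotically stable equilibrium point (at instant $t$) of the differential equation $$\dot x=K_x\,\eta(t,x,y_{\mathrm{ref}}),\qquad K_x>0 .$$
   Context: Problem (P) at instant $t\ge0$: minimize $\sigma(t,\chi)$ over $\chi\in\mathbb{R}^{d_x}$ subject to $0=h(t,\chi)-y_{\mathrm{ref}}(t)$ and $0\ge g(t,\chi):=G(t)\chi+c(t)\in\mathbb{R}^{d_c}$ (componentwise). Here $h:\mathbb{R}_{\ge0}\times\mathbb{R}^{d_x}\to\mathcal Y\subset\mathbb{R}^{d_y}$ is continuous in $t$ and, in the second argument, twice continuously differentiable and surjective. A local minimizer of (P) at $t$ is a feasible point $\chi^{\star}$ for which there is $D>0$ with $\sigma(t,\chi^{\star})<\sigma(t,\chi)$ for every feasible $\chi\ne\chi^{\star}$ with $\|\chi-\chi^{\star}\|_2<D$. A point $x^{\ast}$ is an equilibrium point of the differential equation at instant $t$ iff $K_x\eta(t,x^{\ast},y_{\mathrm{ref}}(t))=0$; stability of such a point is understood for the equation with $t$ and $y_{\mathrm{ref}}(t)$ in $\eta$ held at that instant. Standing assumptions: at every $t\ge0$, (A1) $\sigma(t,\cdot)$ is twice continuously differentiable and strongly convex; (A2) (P) has at least one local minimizer; (A3) if there are several local minimizers they are isolated points; (A4) there is a differentiable $\chi^{\star}:\mathbb{R}_{\ge0}\to\mathbb{R}^{d_x}$ with $\chi^{\star}(t)$ a local minimizer of (P) at $t$ for every $t$. Barrier function: a twice continuously differentiable $\beta:\mathbb{R}\to\mathbb{R}_{\ge0}$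 with $\beta(z)\gg\beta(0)\ge\beta(s)\ge0$ for all $z>0$, $s<0$ (where $\gg$ means ''much larger than''), and such that for every $t\ge 0$ and every strongly convex $\sigma(t,\cdot)$ the augmented cost $\rho(t,\chi):=\sigma(t,\chi)+\frac12\boldsymbol\beta(g(t,\chi))^{\top}\boldsymbol\beta(g(t,\chi))$ is strongly convex in $\chi$; $\boldsymbol\beta$ applies $\beta$ elementwise. An example is $\beta(s)=\frac{p_2}{p_1}\ln(1+e^{p_1s})$ with $p_1,p_2$ sufficiently large ($p_1\to+\infty$). Notation: $r:=[\partial\rho/\partial x]^{\top}$, $R:=\partial r/\partial x$, $H:=\partial h/\partial x$; $A^{\#}_{W}:=W^{-1}A^{\top}(AW^{-1}A^{\top})^{-1}$ for symmetric positive definite $W$ (inverses occurring are assumed to exist, i.e. $H$ has full row rank); and $$\eta(t,x,y_{\mathrm{ref}}):=H(t,x)^{\#}_{R(t,x)}\big(y_{\mathrm{ref}}-h(t,x)\big)-\big(I-H(t,x)^{\#}_{R(t,x)}H(t,x)\big)R(t,x)^{-1}r(t,x).$$ Standing convention: the barrier is taken sufficiently sharp that the paper identifies, and denotes by the same symbol $\chi^{\star}$, the local minimizers of (P), the local minimizers of ''minimize $\rho(t,\chi)$ subject to $h(t,\chi)=y_{\mathrm{ref}}(t)$'', and the $\chi$-components of the roots $(\chi,\zeta)$ of $r(t,\chi)-H(t,\chi)^{\top}\zeta=0$, $-h(t,\chi)+y_{\mathrm{ref}}(t)=0$. *)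

(* Defs.v *)
(* MathComp-Analysis: vectors are columns ['cV[R]_n] over a [realType]. *)
From HB Require Import structures.
From mathcomp Require Export all_boot all_order all_algebra.
From mathcomp Require Export all_classical all_reals all_analysis.
Set Implicit Arguments.
Unset Strict Implicit.
Unset Printing Implicit Defensive.
Export Order.TTheory GRing.Theory Num.Theory.
Export numFieldNormedType.Exports.

Local Open Scope classical_set_scope.
Local Open Scope ring_scope.

(* The library's norm on matrices is the sup norm, hence this definition;
   both induce the same topology. *)
Definition norm2 (R : realType) (n : nat) (x : 'cV[R]_n) : R :=
  Num.sqrt (\sum_(i < n) x i 0 ^+ 2).

Definition gradient (R : realType) (n : nat) (f : 'cV[R]_n -> R)
    (x : 'cV[R]_n) : 'cV[R]_n :=
  \col_j 'D_(delta_mx j 0) f x.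

(* The library's ['J] is for row vectors and is the transpose of this one. *)
Definition jacobian_mx (R : realType) (n m : nat)
    (f : 'cV[R]_n -> 'cV[R]_m) (x : 'cV[R]_n) : 'M[R]_(m, n) :=
  \matrix_(i, j) 'D_(delta_mx j 0) (fun z => f z i 0) x.

(* Used only for finite-dimensional [V]; there, continuity of all directional
   derivatives is continuity of the differential. *)
Definition C1 (R : realType) (V W : normedModType R) (f : V -> W) : Prop :=
  (forall x, differentiable f x) /\ (forall v, continuous (fun x => 'D_v f x)).

Definition C2 (R : realType) (V W : normedModType R) (f : V -> W) : Prop :=
  C1 f /\ forall v, C1 (fun x => 'D_v f x).

Definition strongly_convex (R : realType) (n : nat)
    (f : 'cV[R]_n -> R) : Prop :=
  exists2 m : R, 0 < m & forall (x y : 'cV[R]_n) (l : R), 0 <= l <= 1 ->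
    f (l *: x + (1 - l) *: y) <=
      l * f x + (1 - l) * f y - m / 2 * l * (1 - l) * norm2 (x - y) ^+ 2.

(* One-sided at an endpoint belonging to [D]; meant for [s] a non-isolated
   point of [D]. *)
Definition derivative_within (R : realType) (n : nat) (D : set R)
    (f : R -> 'cV[R]_n) (s : R) (l : 'cV[R]_n) : Prop :=
  (fun u => (u - s)^-1 *: (f u - f s)) @ within D s^' --> l.

Definition local_minimizers (R : realType) (n : nat) (cost : 'cV[R]_n -> R)
    (S : set 'cV[R]_n) : set 'cV[R]_n :=
  [set x | S x /\ exists2 D : R, 0 < D &
     forall z, S z -> z <> x -> norm2 (z - x) < D -> cost x < cost z].

Definition affine_map (R : realType) (dx dc : nat) (G : 'M[R]_(dc, dx))
    (c : 'cV[R]_dc) (x : 'cV[R]_dx) : 'cV[R]_dc :=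
  G *m x + c.

Definition equality_feasible (R : realType) (dx dy : nat)
    (h : 'cV[R]_dx -> 'cV[R]_dy) (y : 'cV[R]_dy) : set 'cV[R]_dx :=
  [set x | h x - y = 0].

Definition feasible (R : realType) (dx dy dc : nat)
    (h : 'cV[R]_dx -> 'cV[R]_dy) (y : 'cV[R]_dy)
    (g : 'cV[R]_dx -> 'cV[R]_dc) : set 'cV[R]_dx :=
  equality_feasible h y `&` [set x | forall i, g x i 0 <= 0].

Definition augmented_cost (R : realType) (dx dc : nat) (beta : R -> R)
    (g : 'cV[R]_dx -> 'cV[R]_dc) (sigma : 'cV[R]_dx -> R)
    (x : 'cV[R]_dx) : R :=
  sigma x + 2^-1 * ((map_mx beta (g x))^T *m map_mx beta (g x)) 0 0.

(* "beta z is much larger than beta 0" is rendered by its only exact content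
   valid for every z > 0, the strict inequality. *)
Definition barrier (R : realType) (dx dc : nat) (G : R -> 'M[R]_(dc, dx))
    (c : R -> 'cV[R]_dc) (beta : R -> R) : Prop :=
  [/\ C2 beta,
      forall z, 0 <= beta z,
      forall z s, 0 < z -> s < 0 -> beta 0 < beta z /\ beta s <= beta 0 &
      forall (t : R) (sigma : 'cV[R]_dx -> R), 0 <= t ->
        C2 sigma -> strongly_convex sigma ->
        strongly_convex (augmented_cost beta (affine_map (G t) (c t)) sigma)].

Definition stationary_points (R : realType) (dx dy : nat)
    (rho : 'cV[R]_dx -> R) (h : 'cV[R]_dx -> 'cV[R]_dy) (y : 'cV[R]_dy) :
    set 'cV[R]_dx :=
  [set x | exists zeta : 'cV[R]_dy,
     gradient rho x - (jacobian_mx h x)^T *m zeta = 0 /\ - h x + y = 0].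

(* A^#_W *)
Definition weighted_pinv (R : realType) (m n : nat) (W : 'M[R]_n)
    (A : 'M[R]_(m, n)) : 'M[R]_(n, m) :=
  invmx W *m A^T *m invmx (A *m invmx W *m A^T).

Definition eta (R : realType) (dx dy : nat) (rho : 'cV[R]_dx -> R)
    (h : 'cV[R]_dx -> 'cV[R]_dy) (x : 'cV[R]_dx) (y : 'cV[R]_dy) :
    'cV[R]_dx :=
  let r := gradient rho in
  let Rx := jacobian_mx r x in
  let H := jacobian_mx h x in
  let Hp := weighted_pinv Rx H in
  Hp *m (y - h x) - (1%:M - Hp *m H) *m (invmx Rx *m r x).

(* Solutions of x' = F(x) on [0, T[, where T may be +oo. *)
Definition solution (R : realType) (n : nat) (F : 'cV[R]_n -> 'cV[R]_n)
    (T : \bar R) (x : R -> 'cV[R]_n) : Prop :=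
  forall s : R, 0 <= s -> (s%:E < T)%E ->
    derivative_within [set u : R | 0 <= u /\ (u%:E < T)%E] x s (F (x s)).

Definition equilibrium (R : realType) (n : nat) (F : 'cV[R]_n -> 'cV[R]_n)
    (xs : 'cV[R]_n) : Prop :=
  F xs = 0.

(* Solutions need not be unique, as R^-1 is merely continuous in x: both
   conditions range over all solutions, stability also over those defined on
   a bounded interval only.  Local solutions exist as F is continuous (Peano),
   and those staying bounded extend to [0, +oo[. *)
Definition stable (R : realType) (n : nat) (F : 'cV[R]_n -> 'cV[R]_n)
    (xs : 'cV[R]_n) : Prop :=
  forall eps : R, 0 < eps -> exists2 delta : R, 0 < delta &
    forall (T : \bar R) (x : R -> 'cV[R]_n), solution F T x ->
      norm2 (x 0 - xs) < delta ->
      forall s : R, 0 <= s -> (s%:E < T)%E -> norm2 (x s - xs) < eps.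

Definition attractive (R : realType) (n : nat) (F : 'cV[R]_n -> 'cV[R]_n)
    (xs : 'cV[R]_n) : Prop :=
  exists2 delta : R, 0 < delta &
    forall x : R -> 'cV[R]_n, solution F +oo%E x ->
      norm2 (x 0 - xs) < delta -> x s @[s --> +oo] --> xs.

Definition asymptotically_stable (R : realType) (n : nat)
    (F : 'cV[R]_n -> 'cV[R]_n) (xs : 'cV[R]_n) : Prop :=
  stable F xs /\ attractive F xs.

(* Main.v *)
(* Put e(x) = h(x) - y, and let r and A be the gradient and the Hessian of rho.
   Multiplying the equation by H gives e' = -K e along solutions, so
   e(s) = exp(-K (s - a)) e(a).  With p = (I - H^# H) A^-1 r one has H p = 0 and
   r = A p + H^T z, hence r^T p = p^T A p >= k |p|^2 by strong convexity, and
   rho' <= K (kappa(x) |e| - k |p|^2).  The exact penalty function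
   V = rho - rho(chi) + C |e| with C large is therefore a strict Lyapunov
   function on a small ball around chi: it decreases at rate at least
   K (k |p|^2 + |e|), which vanishes only at stationary points, and it is positive
   off chi because H^# (y - h) is a descent direction of V wherever e <> 0, so
   that a minimizer of V over the ball is feasible.  No second-order sufficient
   condition at chi and no implicit function theorem are needed. *)
From HB Require Import structures.
Require Import Defs.
From mathcomp Require Import ring lra.
Local Open Scope classical_set_scope.
Local Open Scope ring_scope.

Set Implicit Arguments.
Unset Strict Implicit.
Unset Printing Implicit Defensive.

(** * The Euclidean norm and matrix-valued functions *)

Section Norm2.
Context {R : realType} {n : nat}.
Implicit Types x y : 'cV[R]_n.

Lemma norm2_ge0 x : 0 <= norm2 x. Proof. exact: sqrtr_ge0. Qed.

Lemma sqr_norm2 x : norm2 x ^+ 2 = \sum_i x i 0 ^+ 2.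
Proof. by rewrite sqr_sqrtr// sumr_ge0// => i _; rewrite sqr_ge0. Qed.

Lemma norm2_0 : norm2 (0 : 'cV[R]_n) = 0.
Proof. by rewrite /norm2 big1 ?sqrtr0// => i _; rewrite mxE expr0n. Qed.

Lemma norm2Z (a : R) x : norm2 (a *: x) ^+ 2 = a ^+ 2 * norm2 x ^+ 2.
Proof. by rewrite !sqr_norm2 mulr_sumr; apply: eq_bigr => i _; rewrite mxE exprMn. Qed.

Lemma norm2_eq0 x : norm2 x = 0 -> x = 0.
Proof.
move=> x0; have /eqP : \sum_i x i 0 ^+ 2 = 0 by rewrite -sqr_norm2 x0 expr0n.
rewrite psumr_eq0 => [/allP h0|i _]; last exact: sqr_ge0.
apply/colP => i; rewrite mxE; apply/eqP; rewrite -sqrf_eq0.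
by apply: h0; rewrite mem_index_enum.
Qed.

Lemma norm2N x : norm2 (- x) = norm2 x.
Proof. by rewrite /norm2; congr Num.sqrt; apply: eq_bigr => i _; rewrite mxE sqrrN. Qed.

Lemma norm2_coord x i : `|x i 0| <= norm2 x.
Proof.
rewrite -sqrtr_sqr ler_sqrt.
  by rewrite (bigD1 i)//= lerDl sumr_ge0// => j _; exact: sqr_ge0.
by rewrite sumr_ge0// => j _; rewrite sqr_ge0.
Qed.

Lemma norm_le_norm2 x : `|x| <= norm2 x.
Proof.
rewrite [leLHS]/Num.norm /= mx_normrE; apply/bigmax_leP; split; first exact: norm2_ge0.
by move=> [i j] _ /=; rewrite ord1; exact: norm2_coord.
Qed.

Lemma norm2_continuous (z : 'cV[R]_n) : continuous (fun x => norm2 (x - z)).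
Proof.
move=> x; apply: (@continuous_comp _ _ _ _ Num.sqrt); last exact: sqrt_continuous.
move: x; apply: continuous_big => [|i _ x]; first exact: add_continuous.
have -> : (fun y : 'cV[R]_n => (y - z) i 0 ^+ 2) = (fun y => (y i 0 - z i 0) ^+ 2).
  by apply/funext => y; rewrite !mxE.
apply: (@continuous_comp _ _ _ (fun y : 'cV[R]_n => y i 0 - z i 0) (fun t => t ^+ 2)).
  by apply: continuousB; [exact: coord_continuous|exact: cst_continuous].
exact: exprn_continuous.
Qed.

(** Since the sup norm is at most [norm2], the Euclidean ball lies inside the library's ball of the
    same radius. *)
Lemma nbhs_norm2 x (A : set 'cV[R]_n) : nbhs x A ->
  exists2 r : R, 0 < r & forall z, norm2 (z - x) < r -> A z.
Proof.
move=> /nbhs_ballP[e e0 eA]; exists e => // z ze; apply: eA.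
by rewrite -ball_normE/= distrC (le_lt_trans (norm_le_norm2 _)).
Qed.

End Norm2.

Lemma trmx_continuous (R : realType) m n : continuous (@trmx R m n).
Proof.
move=> M A /nbhs_ballP[e e0 eA]; apply/nbhs_ballP; exists e => // N [_ MN].
by apply: eA; split => // i j; rewrite !mxE; exact: MN.
Qed.

Lemma compact_norm2_ball (R : realType) n (z : 'cV[R]_n) r :
  compact [set x | norm2 (x - z) <= r].
Proof.
set B := (X in compact X).
have cB : closed B.
  have -> : B = (fun x => norm2 (x - z)) @^-1` [set t | t <= r] by [].
  apply: closed_comp; last exact: closed_le.
  by move=> x _; exact: norm2_continuous.
(* Heine-Borel is applied to the transposed set of row vectors, and compactness is carried back
   along the continuous map [trmx]. *)
have -> : B = trmx @` (trmx @^-1` B).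
  by apply/seteqP; split=> [x Bx|x [y By <-]//]; exists x^T; rewrite /= trmxK.
apply: continuous_compact.
  by apply: continuous_subspaceT; exact: trmx_continuous.
apply: bounded_closed_compact; last first.
  by apply: closed_comp => // x _; exact: trmx_continuous.
exists (norm2 z + r); split; first exact: num_real.
move=> M rM v /= Bv; apply: le_trans (ltW rM).
rewrite [leLHS]/Num.norm/= mx_normrE; apply/bigmax_leP; split.
  by rewrite addr_ge0 ?norm2_ge0// (le_trans (norm2_ge0 _) Bv).
move=> [i j] _ /=; rewrite ord1.
have := le_trans (norm2_coord _ j) Bv; rewrite !mxE => vz.
rewrite -[v _ _](subrK (z j 0)) (le_trans (ler_normD _ _))// addrC.
by rewrite lerD// norm2_coord.
Qed.

(** * Continuity of matrix-valued maps *)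

Section EntrywiseContinuity.
Context {R : realType} {T : topologicalType}.

(** Working entry by entry reduces products, determinants and inverses to real sums, products and
    quotients. *)
Definition mx_cts m n (A : T -> 'M[R]_(m, n)) :=
  forall i j, continuous (fun x => A x i j).

Lemma continuous_add (f g : T -> R) :
  continuous f -> continuous g -> continuous (fun x => f x + g x).
Proof. by move=> cf cg x; apply: cvgD; [exact: cf|exact: cg]. Qed.

Lemma continuous_mul (f g : T -> R) :
  continuous f -> continuous g -> continuous (fun x => f x * g x).
Proof. by move=> cf cg x; apply: cvgM; [exact: cf|exact: cg]. Qed.

Lemma continuous_sum (I : Type) (r : seq I) (P : pred I) (f : I -> T -> R) :
  (forall i, P i -> continuous (f i)) ->
  continuous (fun x => \sum_(i <- r | P i) f i x).
Proof. by move=> cf; apply: continuous_big => //; exact: add_continuous. Qed.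

Lemma continuous_prod (I : Type) (r : seq I) (P : pred I) (f : I -> T -> R) :
  (forall i, P i -> continuous (f i)) ->
  continuous (fun x => \prod_(i <- r | P i) f i x).
Proof. by move=> cf; apply: continuous_big => //; exact: mul_continuous. Qed.

Lemma mx_cts_tr m n (A : T -> 'M[R]_(m, n)) :
  mx_cts A -> mx_cts (fun x => (A x)^T).
Proof. by move=> cA i j; under eq_fun do rewrite mxE; exact: cA. Qed.

Lemma mx_cts_mul m n p (A : T -> 'M[R]_(m, n)) (B : T -> 'M[R]_(n, p)) :
  mx_cts A -> mx_cts B -> mx_cts (fun x => A x *m B x).
Proof.
move=> cA cB i j; under eq_fun do rewrite mxE.
by apply: continuous_sum => k _; apply: continuous_mul; [exact: cA|exact: cB].
Qed.

Lemma mx_cts_add m n (A B : T -> 'M[R]_(m, n)) :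
  mx_cts A -> mx_cts B -> mx_cts (fun x => A x + B x).
Proof.
move=> cA cB i j; under eq_fun do rewrite mxE.
by apply: continuous_add; [exact: cA|exact: cB].
Qed.

Lemma mx_cts_opp m n (A : T -> 'M[R]_(m, n)) :
  mx_cts A -> mx_cts (fun x => - A x).
Proof.
move=> cA i j; under eq_fun do rewrite mxE.
by move=> x; apply: continuousN; exact: cA.
Qed.

Lemma mx_cts_cst m n (A : 'M[R]_(m, n)) : mx_cts (fun _ => A).
Proof. by move=> i j; exact: cst_continuous. Qed.

Lemma continuous_det n (A : T -> 'M[R]_n) :
  mx_cts A -> continuous (fun x => \det (A x)).
Proof.
move=> cA; rewrite /determinant; apply: continuous_sum => s _; apply: continuous_mul.
  exact: cst_continuous.
apply: continuous_prod => i _; exact: cA.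
Qed.

(** Cramer's rule: each entry of the inverse is a cofactor divided by a determinant that never
    vanishes. *)
Lemma mx_cts_inv n (A : T -> 'M[R]_n) :
  mx_cts A -> (forall x, A x \in unitmx) -> mx_cts (fun x => invmx (A x)).
Proof.
move=> cA uA i j.
have -> : (fun x => invmx (A x) i j) = (fun x => (\det (A x))^-1 * cofactor (A x) j i).
  by apply/funext => x; rewrite /invmx uA !mxE.
apply: continuous_mul => [x|].
  apply: cvgV; last exact: continuous_det.
  by have := uA x; rewrite unitmxE unitfE.
apply: continuous_mul; first exact: cst_continuous.
by apply: continuous_det => k l; under eq_fun do rewrite !mxE; exact: cA.
Qed.

Lemma continuous_norm2 n (p : T -> 'cV[R]_n) :
  mx_cts p -> continuous (fun x => norm2 (p x)).
Proof.
move=> cp x; apply: (@continuous_comp _ _ _ _ Num.sqrt); last exact: sqrt_continuous.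
move: x; apply: continuous_sum => i _ x.
apply: (@continuous_comp _ _ _ (fun y => p y i 0) (fun t => t ^+ 2)).
  exact: cp.
exact: exprn_continuous.
Qed.

End EntrywiseContinuity.

(* The matrix A need not be symmetric. *)
Section WeightedPseudoInverse.
Context {R : realType} {n m : nat} (A : 'M[R]_n) (H : 'M[R]_(m, n)).

(** For the Hessian of [rho], [c] will be the modulus of strong convexity, the same at every
    point. *)
Definition coercive_mx (c : R) :=
  forall u : 'cV[R]_n, c * norm2 u ^+ 2 <= (u^T *m A *m u) 0 0.

Hypotheses (c : R) (c0 : 0 < c) (Ac : coercive_mx c) (rfH : row_free H).

Lemma coercive_eq0 (u : 'cV[R]_n) : u^T *m A *m u = 0 -> u = 0.
Proof.
move=> u0; apply: norm2_eq0; apply/eqP; rewrite -sqrf_eq0.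
have := Ac u; rewrite u0 mxE pmulr_rle0// => h.
by rewrite eq_le h sqr_ge0.
Qed.

Lemma cV_inj_unitmx p (B : 'M[R]_p) :
  (forall u : 'cV_p, B *m u = 0 -> u = 0) -> B \in unitmx.
Proof.
move=> B0; rewrite -unitmx_tr -row_free_unit -kermx_eq0; apply/eqP.
apply/row_matrixP => i; rewrite row0; apply: trmx_inj; rewrite trmx0; apply: B0.
by apply: trmx_inj; rewrite trmx_mul trmxK trmx0 -row_mul mulmx_ker row0.
Qed.

Lemma coercive_unitmx : A \in unitmx.
Proof.
by apply: cV_inj_unitmx => u Au; apply: coercive_eq0; rewrite -mulmxA Au mulmx0.
Qed.

(** If [z] is in the kernel, then [w] = A^-1 H^T z satisfies A w = H^T z and H w = 0, so w^T A w =
    0. Coercivity gives w = 0, hence H^T z = 0, and full row rank gives z = 0. *)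
Lemma schur_unitmx : H *m invmx A *m H^T \in unitmx.
Proof.
have uA := coercive_unitmx.
apply: cV_inj_unitmx => z Sz; set w := invmx A *m (H^T *m z).
have Aw : A *m w = H^T *m z by rewrite mulKVmx.
have Hw : H *m w = 0 by rewrite /w !mulmxA.
have w0 : w = 0.
  apply: coercive_eq0; rewrite -mulmxA Aw.
  have -> : w^T *m (H^T *m z) = (z^T *m (H *m w))^T.
    by rewrite [RHS]trmx_mul [(H *m w)^T]trmx_mul trmxK mulmxA.
  by rewrite Hw mulmx0 trmx0.
have : z^T *m H = 0 by apply: trmx_inj; rewrite trmx_mul trmxK -Aw w0 mulmx0 trmx0.
move/(congr1 (fun M => M *m pinvmx H)); rewrite -mulmxA mulmxVp// mulmx1 mul0mx.
by move=> z0; apply: trmx_inj; rewrite z0 trmx0.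
Qed.

Local Notation Hp := (weighted_pinv A H).

Lemma mul_weighted_pinv : H *m Hp = 1%:M.
Proof. by rewrite /weighted_pinv !mulmxA mulmxV// schur_unitmx. Qed.

(** A gradient of the form H^T z, as at a stationary point, yields no projected step: the Schur
    complement cancels its inverse. *)
Lemma weighted_pinv_proj (z : 'cV[R]_m) :
  (1%:M - Hp *m H) *m (invmx A *m (H^T *m z)) = 0.
Proof.
rewrite mulmxBl mul1mx -[_ *m H *m _]mulmxA.
have -> : H *m (invmx A *m (H^T *m z)) = H *m invmx A *m H^T *m z.
  by rewrite !mulmxA.
rewrite /weighted_pinv -[_ *m invmx (_ *m _) *m _]mulmxA mulKmx ?schur_unitmx//.
by rewrite mulmxA subrr.
Qed.

Definition projected_step (r : 'cV[R]_n) := (1%:M - Hp *m H) *m (invmx A *m r).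

Lemma mul_projected_step r : H *m projected_step r = 0.
Proof.
rewrite /projected_step mulmxA mulmxBr mulmx1 [H *m (Hp *m H)]mulmxA.
by rewrite mul_weighted_pinv mul1mx subrr mul0mx.
Qed.

(** With S = H A^-1 H^T the multiplier is z = S^-1 H A^-1 r. When the step vanishes, this is the
    stationarity equation r = H^T z. *)
Lemma projected_step_decomp r : exists z, r = A *m projected_step r + H^T *m z.
Proof.
exists (invmx (H *m invmx A *m H^T) *m (H *m (invmx A *m r))).
have uA := coercive_unitmx.
rewrite /projected_step mulmxBl mul1mx mulmxBr mulKVmx//.
by rewrite /weighted_pinv -!mulmxA mulKVmx// subrK.
Qed.

Lemma projected_step_descent r :
  c * norm2 (projected_step r) ^+ 2 <= (r^T *m projected_step r) 0 0.
Proof.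
have := mul_projected_step r; have [z] := projected_step_decomp r.
move: (projected_step r) => p rE Hp0.
(* The term z^T H p drops out. As [A] may fail to be symmetric, r^T p is matched with the transpose
   of the scalar p^T A p. *)
have -> : r^T *m p = (p^T *m A *m p)^T.
  rewrite rE linearD/= mulmxDl !trmx_mul !trmxK -[z^T *m _ *m _]mulmxA Hp0.
  by rewrite mulmx0 addr0 mulmxA.
by rewrite mxE; exact: Ac.
Qed.

End WeightedPseudoInverse.

(** * Smooth functions and strong convexity *)

Section SmoothFunctions.
Context {R : realType} {V : normedModType R}.
Implicit Types f g : V -> R.

Lemma C1_continuous (W : normedModType R) (f : V -> W) : C1 f -> continuous f.
Proof. by case=> df _ x; exact: differentiable_continuous. Qed.

Lemma C1_cst (a : R) : C1 (fun _ : V => a).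
Proof.
split=> [x|v]; first exact: differentiable_cst.
under eq_fun do rewrite derive_cst.
exact: cst_continuous.
Qed.

Lemma C1D f g : C1 f -> C1 g -> C1 (f \+ g).
Proof.
move=> [df cf] [dg cg]; split=> [x|v]; first exact: differentiableD.
rewrite (_ : (fun x => 'D_v (f \+ g) x) = (fun x => 'D_v f x + 'D_v g x)).
  by move=> x; apply: cvgD; [exact: cf|exact: cg].
by apply/funext => x; rewrite deriveD//; exact: diff_derivable.
Qed.

Lemma C1M f g : C1 f -> C1 g -> C1 (f \* g).
Proof.
move=> f1 g1; have [[df cf] [dg cg]] := (f1, g1).
split=> [x|v]; first exact: differentiableM.
rewrite (_ : (fun x => 'D_v (f \* g) x) = (fun x => f x * 'D_v g x + g x * 'D_v f x)).
  apply: continuous_add; apply: continuous_mul.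
  - exact: C1_continuous f1.
  - exact: cg.
  - exact: C1_continuous g1.
  - exact: cf.
by apply/funext => x; rewrite deriveM//; exact: diff_derivable.
Qed.

Lemma derive_comp (phi : R -> R) g x v :
  differentiable phi (g x) -> differentiable g x ->
  'D_v (phi \o g) x = 'D_1 phi (g x) * 'D_v g x.
Proof.
move=> dphi dg; rewrite !deriveE//; last exact: differentiable_comp.
have dE (w : R) : 'd phi (g x) w = 'd phi (g x) 1 * w.
  by rewrite -{1}[w]mulr1 linearZ/= mulrC.
by rewrite diff_comp//= dE.
Qed.

Lemma C1_comp (phi : R -> R) g : C1 phi -> C1 g -> C1 (phi \o g).
Proof.
move=> [dphi cphi] g1; have [dg cg] := g1.
split=> [x|v]; first exact: differentiable_comp.
rewrite (_ : (fun x => 'D_v (phi \o g) x) = (fun x => 'D_1 phi (g x) * 'D_v g x)).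
  apply: continuous_mul; last exact: cg.
  move=> x; apply: (@continuous_comp _ _ _ g (fun y => 'D_1 phi y)).
    exact: C1_continuous.
  exact: cphi.
by apply/funext => x; rewrite derive_comp.
Qed.

Lemma C2_cst (a : R) : C2 (fun _ : V => a).
Proof.
split=> [|v]; first exact: C1_cst.
under eq_fun do rewrite derive_cst.
exact: C1_cst.
Qed.

Lemma C2D f g : C2 f -> C2 g -> C2 (f \+ g).
Proof.
move=> [f1 f2] [g1 g2]; split=> [|v]; first exact: C1D.
rewrite (_ : (fun x => 'D_v (f \+ g) x) = (fun x => 'D_v f x) \+ (fun x => 'D_v g x)).
  exact: (C1D (f2 v) (g2 v)).
by apply/funext => x; rewrite deriveD//; apply: diff_derivable; [case: f1|case: g1].
Qed.

Lemma C2M f g : C2 f -> C2 g -> C2 (f \* g).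
Proof.
move=> [f1 f2] [g1 g2]; split=> [|v]; first exact: C1M.
rewrite (_ : (fun x => 'D_v (f \* g) x) =
    (f \* (fun x => 'D_v g x)) \+ (g \* (fun x => 'D_v f x))).
  exact: (C1D (C1M f1 (g2 v)) (C1M g1 (f2 v))).
by apply/funext => x; rewrite deriveM//; apply: diff_derivable; [case: f1|case: g1].
Qed.

Lemma C2_comp (phi : R -> R) g : C2 phi -> C2 g -> C2 (phi \o g).
Proof.
move=> [p1 p2] [g1 g2]; split=> [|v]; first exact: C1_comp.
rewrite (_ : (fun x => 'D_v (phi \o g) x) =
    ((fun y => 'D_1 phi y) \o g) \* (fun x => 'D_v g x)).
  exact: (C1M (C1_comp (p2 1) g1) (g2 v)).
by apply/funext => x; rewrite derive_comp//; [case: p1|case: g1].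
Qed.

Lemma C2_sum (I : Type) (r : seq I) (f : I -> V -> R) :
  (forall i, C2 (f i)) -> C2 (fun x => \sum_(i <- r) f i x).
Proof.
move=> f2; elim: r => [|i r IH].
  by under eq_fun do rewrite big_nil; exact: C2_cst.
by under eq_fun do rewrite big_cons; exact: (C2D (f2 i) IH).
Qed.

Lemma C2_linear (f : {linear V -> R}) : continuous f -> C2 f.
Proof.
move=> cf; have df x : differentiable f x by exact: linear_differentiable.
have Df v : (fun x => 'D_v f x) = cst (f v).
  by apply/funext => x; rewrite deriveE// diff_lin.
by split=> [|v]; [split=> // v|]; rewrite Df; [exact: cst_continuous|exact: C1_cst].
Qed.

End SmoothFunctions.

(** * Gradients, Jacobians and Hessians in coordinates *)

Section Gradient.
Context {R : realType} {n : nat}.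
Implicit Types (f : 'cV[R]_n -> R) (x v : 'cV[R]_n).

Lemma cV_delta_sum v : v = \sum_j v j 0 *: delta_mx j 0.
Proof. by rewrite [LHS]matrix_sum_delta; apply: eq_bigr => i _; rewrite big_ord1. Qed.

Lemma derive_sum_delta f x v : differentiable f x ->
  'D_v f x = \sum_j v j 0 * 'D_(delta_mx j 0) f x.
Proof.
move=> df; rewrite deriveE// {1}(cV_delta_sum v) linear_sum/=.
by apply: eq_bigr => j _; rewrite linearZ deriveE.
Qed.

Lemma derive_gradient f x v : differentiable f x ->
  'D_v f x = ((gradient f x)^T *m v) 0 0.
Proof.
move=> df; rewrite derive_sum_delta// mxE; apply: eq_bigr => j _.
by rewrite !mxE mulrC.
Qed.

Lemma differentiable_entry m p (h : 'cV[R]_n -> 'M[R]_(m, p)) x i j :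
  differentiable h x -> differentiable (fun z => h z i j) x.
Proof.
move=> dh; apply: (@differentiable_comp _ _ _ _ h (fun M : 'M[R]_(m, p) => M i j)) => //.
exact: differentiable_coord.
Qed.

Lemma derive_entry m p (h : 'cV[R]_n -> 'M[R]_(m, p)) x v i j :
  differentiable h x -> ('D_v h x) i j = 'D_v (fun z => h z i j) x.
Proof. by move=> dh; rewrite derive_mx ?mxE//; exact: diff_derivable. Qed.

Lemma derive_jacobian m (h : 'cV[R]_n -> 'cV[R]_m) x v : differentiable h x ->
  'D_v h x = jacobian_mx h x *m v.
Proof.
move=> dh; apply/colP => i; rewrite derive_entry// derive_sum_delta.
  by rewrite mxE; apply: eq_bigr => j _; rewrite !mxE mulrC.
exact: differentiable_entry.
Qed.

(** Expand 'D_v f as a combination of the partial derivatives with the constant weights [v i 0],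
    then differentiate once more along [v]. *)
Lemma derive_hessian f x v : C2 f ->
  'D_v (fun z => 'D_v f z) x = (v^T *m jacobian_mx (gradient f) x *m v) 0 0.
Proof.
move=> [[df _] f2].
have -> : (fun z => 'D_v f z) = \sum_i (v i 0 *: (fun z => 'D_(delta_mx i 0) f z)).
  by apply/funext => z; rewrite derive_sum_delta// fct_sumE.
have dD i : differentiable (fun z => 'D_(delta_mx i 0) f z) x.
  by case: (f2 (delta_mx i 0)).
rewrite derive_sum => [|i]; last by apply: derivableZ; exact: diff_derivable.
rewrite -mulmxA mxE; apply: eq_bigr => i _.
rewrite deriveZ/=; last exact: diff_derivable.
rewrite derive_sum_delta// !mxE; congr (_ * _); apply: eq_bigr => j _.
rewrite !mxE mulrC; congr (_ * _).
by congr (derive _ x _); apply/funext => z; rewrite mxE.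
Qed.

Lemma gradient_cts f : C1 f -> mx_cts (gradient f).
Proof. by move=> [_ cf] i j; under eq_fun do rewrite mxE; exact: cf. Qed.

Lemma hessian_cts f : C2 f -> mx_cts (jacobian_mx (gradient f)).
Proof.
move=> [_ f2] i j; under eq_fun do rewrite mxE.
have -> : (fun z => gradient f z i 0) = (fun z => 'D_(delta_mx i 0) f z).
  by apply/funext => z; rewrite mxE.
by have [_] := f2 (delta_mx i 0); exact.
Qed.

Lemma jacobian_cts m (h : 'cV[R]_n -> 'cV[R]_m) : C1 h -> mx_cts (jacobian_mx h).
Proof.
move=> [dh ch] i j; under eq_fun do rewrite mxE -derive_entry//.
move=> x; apply: (@continuous_comp _ _ _
  (fun z => 'D_(delta_mx j 0) h z) (fun M : 'cV[R]_m => M i 0)).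
  exact: ch.
exact: coord_continuous.
Qed.

End Gradient.

(** * First- and second-order consequences of strong convexity *)

Section StrongConvexity.
Context {R : realType} {n : nat}.
Implicit Types (f : 'cV[R]_n -> R) (x v : 'cV[R]_n).

(** Convexity inequalities hold for weights in [0, 1] only, so derivatives are read off from the
    right. *)
Lemma derivable_right (W : normedModType R) (f : 'cV[R]_n -> W) x v :
  derivable f x v ->
  (fun l : R => l^-1 *: (f (l *: v + x) - f x)) @ 0^'+ --> 'D_v f x.
Proof. by move=> df; apply: cvg_dnbhs_at_right; exact: df. Qed.

(** The modulus is exposed because it becomes the coercivity constant of the Hessian. *)
Definition strongly_convex_with (m : R) f := forall x y (l : R), 0 <= l <= 1 ->
  f (l *: x + (1 - l) *: y) <=
    l * f x + (1 - l) * f y - m / 2 * l * (1 - l) * norm2 (x - y) ^+ 2.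

(** Divide the convexity inequality between v + x and x by the weight l and let l tend to 0 from the
    right. *)
Lemma strongly_convex_derive m f x v : strongly_convex_with m f ->
  differentiable f x ->
  'D_v f x <= f (v + x) - f x - m / 2 * norm2 v ^+ 2.
Proof.
move=> scf df.
have /derivable_right : derivable f x v by exact: diff_derivable.
set q := fun l : R => _ => qv.
have bv : (f (v + x) - f x - m / 2 * (1 - l) * norm2 v ^+ 2) @[l --> 0^'+] -->
    f (v + x) - f x - m / 2 * (1 - 0) * norm2 v ^+ 2.
  apply: cvgB; first exact: cvg_cst.
  apply: cvgM; last exact: cvg_cst.
  apply: cvgM; first exact: cvg_cst.
  apply: cvgB; first exact: cvg_cst.
  by apply: cvg_at_right_filter; exact: cvg_id.
have -> : m / 2 * norm2 v ^+ 2 = m / 2 * (1 - 0) * norm2 v ^+ 2 by rewrite subr0 mulr1.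
apply: (ler_cvg_to qv bv); near=> l.
have l0 : 0 < l by [].
have l1 : l <= 1 by near: l; exact: nbhs_right_le.
rewrite /q /GRing.scale/= ler_pdivrMl//.
have := scf (v + x) x l; rewrite addrK (ltW l0) l1 => /(_ isT).
have -> : l *: (v + x) + (1 - l) *: x = l *: v + x.
  by rewrite scalerDr scalerBl scale1r -addrA [l *: x + _]addrC subrK.
by move=> h; nra.
Unshelve. all: by end_near. Qed.

(** Adding the first-order inequalities from x to y = x + l v and from y back to x gives l (D_v f(y)
    - D_v f(x)) >= m l^2 |v|^2. Divide by l^2 and let l tend to 0. *)
Lemma hessian_coercive m f x : strongly_convex_with m f -> C2 f ->
  coercive_mx (jacobian_mx (gradient f) x) m.
Proof.
move=> scf cf v; rewrite -derive_hessian//.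
have df z : differentiable f z by case: cf => -[].
have dD : differentiable (fun z => 'D_v f z) x by case: cf => _ /(_ v)[].
have /derivable_right qv : derivable (fun z => 'D_v f z) x v by exact: diff_derivable.
 apply: (@cvgr_to_ge _ _ _ _ _ _ _ qv).
near=> l.
have l0 : 0 < l by [].
rewrite /GRing.scale/= ler_pdivlMl//.
set y := l *: v + x.
have := strongly_convex_derive (l *: v) scf (df x); rewrite -/y => h1.
have := strongly_convex_derive (- (l *: v)) scf (df y).
rewrite {2}/y addKr => h2.
have DZ (a : R) z : 'D_(a *: v) f z = a * 'D_v f z.
  by rewrite !deriveE//; exact: linearZ.
rewrite norm2N -[- (l *: v)]scaleNr !DZ norm2Z in h1 h2.
rewrite -(ler_pM2l l0) -/y.
by move: h1 h2; clear; lra.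
Unshelve. all: by end_near. Qed.

Lemma C2_augmented_cost dc (beta : R -> R) (G : 'M[R]_(dc, n)) c
    (sigma : 'cV[R]_n -> R) :
  C2 beta -> C2 sigma -> C2 (augmented_cost beta (affine_map G c) sigma).
Proof.
move=> b2 s2.
have g2 i : C2 (fun x => affine_map G c x i 0).
  have -> : (fun x => affine_map G c x i 0) = (fun x => (G *m x) i 0) \+ (fun=> c i 0).
    by apply/funext => x; rewrite /affine_map mxE.
  apply: C2D; last exact: C2_cst.
  have lG : linear (fun x : 'cV[R]_n => (G *m x) i 0).
    by move=> a u w; rewrite linearP/= !mxE.
  pose lm := GRing.isLinear.Build _ _ _ _ _ lG.
  (* Packing the entry as a linear map makes its directional derivatives constant, hence smooth. *)
  pose L : {linear 'cV[R]_n -> R} := HB.pack (fun x : 'cV[R]_n => (G *m x) i 0) lm.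
  apply: (@C2_linear _ _ L).
  rewrite /=; under eq_fun do rewrite mxE.
  apply: continuous_sum => j _; apply: continuous_mul; first exact: cst_continuous.
  exact: coord_continuous.
have -> : augmented_cost beta (affine_map G c) sigma =
    sigma \+ ((fun=> 2^-1) \* (fun x => \sum_i
      ((beta \o (fun x => affine_map G c x i 0)) \*
       (beta \o (fun x => affine_map G c x i 0))) x)).
  apply/funext => x; rewrite /augmented_cost/= mxE; congr (_ + _ * _).
  by apply: eq_bigr => i _; rewrite !mxE.
have bg2 i := C2_comp b2 (g2 i).
apply: (C2D s2 (C2M (C2_cst _) _)).
exact: (C2_sum _ (fun i => C2M (bg2 i) (bg2 i))).
Qed.

End StrongConvexity.

(** * Lyapunov's theorem without uniqueness of solutions *)

Section Solutions.
Context {R : realType} {n : nat} (F : 'cV[R]_n -> 'cV[R]_n).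
Context (T : \bar R) (x : R -> 'cV[R]_n) (xF : solution F T x).

(** Near [s] the difference quotient is within 1 of F(x s), so |x u - x s| <= (|F(x s)| + 1) |u -
    s|. *)
Lemma solution_continuous a b : 0 <= a -> (b%:E < T)%E ->
  {within `[a, b], continuous x}.
Proof.
move=> a0 bT; apply/subspace_continuousP => s /=; rewrite in_itv/= => /andP[as_ sb].
have s0 : 0 <= s by exact: le_trans as_.
have sT : (s%:E < T)%E by apply: le_lt_trans bT; rewrite lee_fin.
have xs := xF s0 sT.
apply/cvgrPdist_lt => e e0; rewrite near_withinE.
move/cvgrPdist_lt : xs => /(_ 1 ltr01); rewrite near_withinE.
rewrite {1}/dnbhs near_withinE => xs.
pose M := `|F (x s)| + 1.
have M0 : 0 < M by rewrite ltr_wpDl.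
near=> u.
move=> /=; rewrite in_itv/= => /andP[au ub].
have [->|us] := eqVneq u s; first by rewrite subrr normr0.
have uT : (u%:E < T)%E by apply: le_lt_trans bT; rewrite lee_fin.
have u0 : 0 <= u by exact: le_trans au.
have xu : u != s -> 0 <= u /\ (u%:E < T)%E ->
    `|F (x s) - (u - s)^-1 *: (x u - x s)| < 1 by near: u.
have := xu us (conj u0 uT).
set q := _ *: _ => Fq.
have qM : `|q| <= M.
  rewrite -[q](subKr (F (x s))) (le_trans (ler_normB _ _))// lerD2l ltW//.
have -> : x s - x u = - ((u - s) *: q).
  by rewrite /q scalerA divff ?subr_eq0// scale1r opprB.
rewrite normrN normrZ (le_lt_trans (ler_wpM2l (normr_ge0 _) qM))//.
rewrite -ltr_pdivlMr// distrC; near: u.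
by apply: cvgr_dist_lt; [exact: cvg_id|rewrite divr_gt0].
Unshelve. all: by end_near. Qed.

Lemma continuous_along (U : topologicalType) (f : 'cV[R]_n -> U) a b :
  0 <= a -> (b%:E < T)%E -> continuous f -> {within `[a, b], continuous (f \o x)}.
Proof.
move=> a0 bT cf u; apply: (@continuous_comp _ _ _ (x : subspace `[a, b] -> _) f).
  exact: (solution_continuous a0 bT).
exact: cf.
Qed.

(** For 0 < s < T the time domain is a neighbourhood of [s], so the derivative within it is the
    ordinary one. *)
Lemma solution_is_derive s : 0 < s -> (s%:E < T)%E -> is_derive s 1 x (F (x s)).
Proof.
move=> s0 sT; have xs := xF (ltW s0) sT.
suff lim : (fun h : R => h^-1 *: ((x \o shift s) (h *: 1) - x s)) @ 0^' --> F (x s).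
  by apply: DeriveDef; [apply/cvg_ex; exists (F (x s))|exact: cvg_lim].
have sT' : \forall u \near s, (u%:E < T)%E.
  move: sT; case: (T) => [t|_|//]; last by near=> u; exact: ltry.
  by rewrite lte_fin => st; near=> u; rewrite lte_fin; near: u; exact: lt_nbhsl.
have sD : \forall u \near s, 0 <= u /\ (u%:E < T)%E.
  by near=> u; split; [apply: ltW; near: u; exact: lt_nbhsr|near: u].
apply/cvgrPdist_lt => e e0.
move/cvgrPdist_lt : xs => /(_ e e0).
rewrite near_withinE {1}/dnbhs near_withinE => xs.
have /nbhs0P H : \forall u \near s, (0 <= u /\ (u%:E < T)%E) /\
  (u != s -> 0 <= u /\ (u%:E < T)%E ->
    `|F (x s) - (u - s)^-1 *: (x u - x s)| < e) by exact: filterI sD xs.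
rewrite /dnbhs near_withinE; near=> h => h0.
have [hD] : (0 <= h + s /\ ((h + s)%:E < T)%E) /\
  (h + s != s -> 0 <= h + s /\ ((h + s)%:E < T)%E ->
    `|F (x s) - (h + s - s)^-1 *: (x (h + s) - x s)| < e).
  rewrite addrC; near: h; exact: H.
rewrite addrK => /(_ _ hD); rewrite /= [h *: 1]mulr1; apply.
by rewrite -subr_eq0 addrK.
Unshelve. all: by end_near. Qed.

End Solutions.

(** The hitting time is the infimum of the times at which [N] is at least [e]. *)
Lemma first_hitting (R : realType) (N : R -> R) (a b e : R) :
  a <= b -> {within `[a, b], continuous N} -> N a < e -> e <= N b ->
  exists c, [/\ a <= c <= b, N c = e & forall s, a <= s <= c -> N s <= e].
Proof.
move=> ab cN Na Nb.
pose E := [set u | a <= u <= b /\ e <= N u].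
have Eb : E b by split => //; rewrite ab lexx.
have iE : has_inf E by split; [exists b|exists a => u [/andP[]]].
set i := inf E.
have ai : a <= i by apply: lb_le_inf; [exists b|move=> u [/andP[]]].
have ilb u : E u -> i <= u by move=> Eu; apply: ge_inf => //; case: iE.
have ib : i <= b by exact: ilb.
have Nlt s : a <= s -> s < i -> N s < e.
  move=> as_ si; rewrite ltNge; apply/negP => eN.
  have /ilb : E s by split => //; rewrite as_ (le_trans (ltW si)).
  by rewrite leNgt si.
(* Otherwise continuity keeps [N] below [e] just after [i], although members of [E] come arbitrarily
   close to [i]. *)
have Ni : e <= N i.
  rewrite leNgt; apply/negP => Nie.
  have /subspace_continuousP /(_ i) := cN.
  rewrite /= in_itv/= ai ib => /(_ isT) /cvgr_lt /(_ e Nie).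
  rewrite near_withinE => /nbhs_ballP[d /= d0 dN].
  have [u [/andP[au ub] eu] ud] := inf_adherent d0 iE.
  have iu : i <= u by apply: ilb; split => //; rewrite au.
  have := dN u; rewrite /ball/= ler0_norm ?subr_le0// opprB ltrBlDl => /(_ ud).
  by rewrite /= in_itv/= au ub => /(_ isT); rewrite ltNge eu.
(* The intermediate value theorem gives a time of exact equality up to [i]; it belongs to [E], so it
   is [i] itself. *)
have [c] : exists2 c, c \in `[a, i] & N c = e.
  apply: IVT => //.
    apply: continuous_subspaceW cN => u /=; rewrite !in_itv/= => /andP[-> ui] /=.
    exact: le_trans ib.
  by rewrite ge_min (ltW Na) le_max Ni orbT.
rewrite in_itv/= => /andP[ac ci] Nc.
have ic : i <= c by apply: ilb; split; [rewrite ac (le_trans ci)|rewrite Nc].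
have {ci ic} ci : c = i by apply/le_anti; rewrite ci ic.
exists c; split => //; first by rewrite ac ci ib.
move=> s /andP[as_]; rewrite le_eqVlt => /predU1P[->|]; first by rewrite Nc.
by rewrite ci => /(Nlt _ as_) /ltW.
Qed.

Section Lyapunov.
Context {R : realType} {n : nat} (F : 'cV[R]_n -> 'cV[R]_n) (chi : 'cV[R]_n).

Lemma annulus_lower_bound (f : 'cV[R]_n -> R) (r e : R) : continuous f ->
  0 < e -> (forall x, x <> chi -> norm2 (x - chi) <= r -> 0 < f x) ->
  exists2 m : R, 0 < m & forall x, e <= norm2 (x - chi) <= r -> m <= f x.
Proof.
move=> cf e0 fpos.
pose A := [set x : 'cV[R]_n | e <= norm2 (x - chi) <= r].
have cA : compact A.
  apply: (subclosed_compact (B := [set x | norm2 (x - chi) <= r]));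
    [|exact: compact_norm2_ball|by move=> x /= /andP[]].
  have -> : A = (fun x => norm2 (x - chi)) @^-1` [set t | e <= t] `&`
                (fun x => norm2 (x - chi)) @^-1` [set t | t <= r].
    by apply/seteqP; split => x; rewrite /A/= => /andP.
  by apply: closedI; (apply: closed_comp => [x _|]; first exact: norm2_continuous);
    [exact: closed_ge|exact: closed_le].
have [A0|A0] := pselect (A !=set0); last first.
  (* On an empty annulus any positive constant serves. *)
  by exists 1 => // x Ax; exfalso; apply: A0; exists x.
have [c cA' minc] := compact_EVT_min A0 cA (continuous_subspaceT cf).
exists (f c) => [|x Ax]; last by apply: minc; rewrite inE.
move: cA'; rewrite inE => /andP[ec cr]; apply: fpos => // cchi.
by move: ec; rewrite cchi subrr norm2_0 leNgt e0.
Qed.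

(** * Stability and attractivity from a Lyapunov function *)

Context (V Phi : 'cV[R]_n -> R) (r : R) (r0 : 0 < r).
Hypotheses (cV : continuous V) (cPhi : continuous Phi).
Hypotheses (V0 : V chi = 0)
  (Vpos : forall x, x <> chi -> norm2 (x - chi) <= r -> 0 < V x)
  (Phige0 : forall x, norm2 (x - chi) <= r -> 0 <= Phi x)
  (Phipos : forall x, x <> chi -> norm2 (x - chi) <= r -> 0 < Phi x).
(* Integrated form of V' <= - Phi, which does not require V to be differentiable. *)
Hypothesis dissipation : forall T x, solution F T x -> forall a b mu,
  0 <= a -> a <= b -> (b%:E < T)%E ->
  (forall s, a <= s <= b -> norm2 (x s - chi) <= r /\ mu <= Phi (x s)) ->
  V (x b) <= V (x a) - mu * (b - a).

(** [V] is at least some m > 0 between radii [e] and [r] and below m near [chi]; as it cannot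
    increase inside the ball, the sphere of radius [e] is never reached. The arbitrary starting time
    [a] permits a restart in the proof of attractivity. *)
Lemma lyapunov_trapping e : 0 < e -> e <= r -> exists2 d : R, 0 < d &
  forall T x, solution F T x -> forall a, 0 <= a -> norm2 (x a - chi) < d ->
  forall s, a <= s -> (s%:E < T)%E -> norm2 (x s - chi) < e.
Proof.
move=> e0 er; have [m m0 mV] := annulus_lower_bound cV e0 Vpos.
have [d d0 dV] : exists2 d : R, 0 < d & forall z, norm2 (z - chi) < d -> V z < m.
  have /nbhs_norm2[d d0 dV] : \forall z \near chi, V z < m.
    by apply: (cvgr_lt _ (@cV chi)); rewrite V0.
  by exists d.
exists (Num.min d e); first by rewrite lt_min d0.
move=> T x xF a a0; rewrite lt_min => /andP[xad xae] s as_ sT.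
rewrite ltNge; apply/negP => es.
pose N u := norm2 (x u - chi).
have cN : {within `[a, s], continuous N}.
  apply: (continuous_along xF (f := fun z => norm2 (z - chi)) a0 sT).
  exact: norm2_continuous.
have [c [/andP[ac cs] Nc Ne]] := first_hitting as_ cN xae es.
have cT : (c%:E < T)%E by apply: le_lt_trans sT; rewrite lee_fin.
(* Rate [mu] = 0: up to the first time on the sphere, [V] does not increase. *)
have : V (x c) <= V (x a) - 0 * (c - a).
  apply: (dissipation xF) => // u uc.
  have Nu : norm2 (x u - chi) <= r by apply: le_trans er; exact: Ne.
  by split => //; exact: Phige0.
rewrite mul0r subr0 leNgt => /negP; apply.
apply: (lt_le_trans (dV _ xad)); apply: mV; rewrite -/(N c) Nc lexx//.
Qed.

Lemma lyapunov_stable : stable F chi.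
Proof.
move=> e e0; have [||d d0 dP] := @lyapunov_trapping (Num.min e r).
- by rewrite lt_min e0.
- by rewrite ge_min lexx orbT.
exists d => // T x xF x0 s s0 sT.
by have := dP T x xF 0 (lexx _) x0 s s0 sT; rewrite lt_min => /andP[].
Qed.

(** A trapped solution staying at distance at least k from [chi] would lose [V] at a uniform
    positive rate until [V] is negative. Hence it enters the k-ball at some time, and trapping
    applies from then on. *)
Lemma lyapunov_attractive : attractive F chi.
Proof.
have [d d0 dP] := lyapunov_trapping r0 (lexx r).
exists d => // x xF x0.
have xr s : 0 <= s -> norm2 (x s - chi) <= r.
  by move=> s0; apply/ltW/(dP _ x xF 0); rewrite ?ltry.
have Vge0 s : 0 <= s -> 0 <= V (x s).
  move=> s0; have [->|/eqP xs] := eqVneq (x s) chi; first by rewrite V0.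
  by apply/ltW/Vpos => //; exact: xr.
apply/cvgrPdist_lt => e e0.
have [||k k0 kP] := @lyapunov_trapping (Num.min e r).
- by rewrite lt_min e0.
- by rewrite ge_min lexx orbT.
have [a a0 ka] : exists2 a, 0 <= a & norm2 (x a - chi) < k.
  apply: contrapT => Nk.
  have xk s : 0 <= s -> k <= norm2 (x s - chi).
    by move=> s0; rewrite leNgt; apply/negP => xsk; apply: Nk; exists s.
  have [mu mu0 muP] := annulus_lower_bound cPhi k0 Phipos.
  (* After this time, decrease at rate [mu] would force [V] down to -1. *)
  have b0 : 0 <= (V (x 0) + 1) / mu by rewrite divr_ge0 ?ltW// ltr_wpDl// Vge0.
  have := dissipation xF (lexx 0) b0 (ltry _) (mu := mu).
  rewrite subr0 [mu * _]mulrC divfK ?gt_eqF// => H.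
  have : V (x ((V (x 0) + 1) / mu)) <= -1.
    apply: le_trans (H _) _; last by lra.
    move=> s /andP[s0 _]; split; first exact: xr.
    by apply: muP; rewrite xk// xr.
  by rewrite leNgt => /negP; apply; apply: lt_le_trans (Vge0 _ b0); rewrite oppr_lt0.
near=> s.
have as_ : a <= s by near: s; apply: nbhs_pinfty_ge; exact: num_real.
have := kP _ x xF a a0 ka s as_ (ltry _); rewrite lt_min => /andP[se _].
by rewrite distrC (le_lt_trans (norm_le_norm2 _)).
Unshelve. all: by end_near. Qed.

End Lyapunov.

(** * The exact penalty Lyapunov function *)

Lemma continuous_ball_bounded (R : realType) n (f : 'cV[R]_n -> R) (z : 'cV[R]_n) r :
  0 <= r -> continuous f ->
  exists M, forall x, norm2 (x - z) <= r -> f x <= M.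
Proof.
move=> r0 cf.
have Bz : [set x | norm2 (x - z) <= r] !=set0 by exists z; rewrite /= subrr norm2_0.
have [c _ fc] :=
  compact_EVT_max Bz (@compact_norm2_ball _ _ z r) (continuous_subspaceT cf).
by exists (f c) => x xz; apply: fc; rewrite inE.
Qed.

Lemma is_derive_along (R : realType) n (W : normedModType R) (f : 'cV[R]_n -> W)
    (x : R -> 'cV[R]_n) s l :
  differentiable f (x s) -> is_derive s 1 x l ->
  is_derive s 1 (f \o x) ('D_l f (x s)).
Proof.
move=> df [dx xl].
have dx' : differentiable x s by apply/derivable1_diffP.
have dfx : differentiable (f \o x) s by exact: differentiable_comp.
apply: DeriveDef; first by apply/derivable1_diffP.
by rewrite !deriveE//= diff_comp//= -(deriveE _ dx') xl.
Qed.

Lemma is_derive_expR_affine (R : realType) (k a u : R) :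
  is_derive u 1 (fun s => expR (k * (s - a))) (expR (k * (u - a)) * k).
Proof.
apply: (@is_derive1_comp _ expR (fun s => k * (s - a))).
have := is_deriveZ k (is_deriveB (is_derive_id u 1) (is_derive_cst a u 1)).
by rewrite subr0 /GRing.scale/= mulr1.
Qed.

Section GradientFlow.
Context {R : realType} {n m : nat} (rho : 'cV[R]_n -> R) (h : 'cV[R]_n -> 'cV[R]_m).
Context (y : 'cV[R]_m) (chi : 'cV[R]_n) (K c : R).
Hypotheses (K0 : 0 < K) (c0 : 0 < c) (rho2 : C2 rho) (h1 : C1 h).
Hypothesis rhoc : forall x, coercive_mx (jacobian_mx (gradient rho) x) c.
Hypothesis rfH : forall x, row_free (jacobian_mx h x).

Let e (x : 'cV[R]_n) : 'cV[R]_m := h x - y.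
Let A x := jacobian_mx (gradient rho) x.
Let H x := jacobian_mx h x.
Let p x := projected_step (A x) (H x) (gradient rho x).
Let F (x : 'cV[R]_n) : 'cV[R]_n := K *: eta rho h x y.
Let b x := (gradient rho x)^T *m weighted_pinv (A x) (H x).
(** The l1 norm of the row [b x], dual to the sup norm on columns: it bounds the slope of [rho]
    along H^# w by kappa(x) |w|. *)
Let kappa (x : 'cV[R]_n) : R := \sum_j `|b x 0 j|.

Let drho x : differentiable rho x. Proof. by case: rho2 => -[]. Qed.
Let dh x : differentiable h x. Proof. by case: h1. Qed.

Let etaE x : eta rho h x y = weighted_pinv (A x) (H x) *m (- e x) - p x.
Proof. by rewrite /e opprB. Qed.

Let invA_cts : mx_cts (fun x => invmx (A x)).
Proof.
apply: mx_cts_inv; first exact: hessian_cts.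
by move=> x; exact: coercive_unitmx c0 (@rhoc x).
Qed.

Let pinv_cts : mx_cts (fun x => weighted_pinv (A x) (H x)).
Proof.
have cH : mx_cts H by exact: jacobian_cts.
have cAH : mx_cts (fun x => invmx (A x) *m (H x)^T).
  by apply: mx_cts_mul => //; exact: mx_cts_tr.
apply: mx_cts_mul => //; apply: mx_cts_inv => [|x].
  by apply: mx_cts_mul; [exact: mx_cts_mul|exact: mx_cts_tr].
exact: schur_unitmx c0 (@rhoc x) (@rfH x).
Qed.

Let p_cts : mx_cts p.
Proof.
have cg : mx_cts (gradient rho) by apply: gradient_cts; case: rho2.
apply: mx_cts_mul; last exact: mx_cts_mul.
apply: mx_cts_add; first exact: mx_cts_cst.
by apply: mx_cts_opp; apply: mx_cts_mul => //; exact: jacobian_cts.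
Qed.

Let kappa_cts : continuous kappa.
Proof.
apply: continuous_sum => j _ x.
apply: (@continuous_comp _ _ _ (fun x => b x 0 j) Num.norm).
  apply: mx_cts_mul; last exact: pinv_cts.
  by apply: mx_cts_tr; apply: gradient_cts; case: rho2.
exact: norm_continuous.
Qed.

Let e_cts : continuous e.
Proof.
move=> x; apply: differentiable_continuous.
have -> : e = h - cst y by apply/funext.
exact: differentiableB.
Qed.

Let norm_e_cts : continuous (fun x => `|e x|).
Proof.
move=> x; apply: (@continuous_comp _ _ _ e Num.norm); first exact: e_cts.
exact: norm_continuous.
Qed.

Let jacobian_pinv x (w : 'cV[R]_m) : H x *m (weighted_pinv (A x) (H x) *m w) = w.
Proof. by rewrite mulmxA (mul_weighted_pinv c0 (@rhoc x) (@rfH x)) mul1mx. Qed.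

Let jacobian_flow x : H x *m F x = - K *: e x.
Proof.
rewrite -scalemxAr etaE mulmxBr jacobian_pinv.
by rewrite (mul_projected_step c0 (@rhoc x) (@rfH x)) subr0 scalerN scaleNr.
Qed.

Let kappa_bound x (w : 'cV[R]_m) : (b x *m w) 0 0 <= kappa x * `|w|.
Proof.
rewrite mxE mulr_suml; apply: ler_sum => j _.
rewrite (le_trans (ler_norm _))// normrM ler_wpM2l//.
rewrite [leRHS]/Num.norm/= mx_normrE; apply/bigmax_geP; right.
by exists (j, 0).
Qed.

Let derive_flow x :
  'D_(F x) rho x <= K * (kappa x * `|e x| - c * norm2 (p x) ^+ 2).
Proof.
rewrite derive_gradient// -scalemxAr mxE ler_pM2l// etaE mulmxBr mxE.
have k1 : ((gradient rho x)^T *m (weighted_pinv (A x) (H x) *m - e x)) 0 0 <=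
    kappa x * `|e x|.
  by rewrite mulmxA -[`|e x|]normrN; exact: kappa_bound.
have k2 : c * norm2 (p x) ^+ 2 <= ((gradient rho x)^T *m p x) 0 0.
  exact: (projected_step_descent c0 (@rhoc x) (@rfH x)).
rewrite [X in _ + X <= _]mxE; lra.
Qed.

Lemma stationary_equilibrium : stationary_points rho h y chi -> equilibrium F chi.
Proof.
move=> [z [/eqP]]; rewrite subr_eq0 => /eqP rz /eqP; rewrite addrC subr_eq0 => /eqP hy.
rewrite /equilibrium /F etaE /e -hy subrr oppr0 mulmx0 sub0r /p /projected_step rz.
by rewrite (weighted_pinv_proj c0 (@rhoc chi) (@rfH chi)) oppr0 scaler0.
Qed.

Let e_decay T x : solution F T x -> forall a s, 0 <= a -> a <= s -> (s%:E < T)%E ->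
  e (x s) = expR (- K * (s - a)) *: e (x a).
Proof.
move=> xF a s a0 as_ sT; apply/colP => i.
(* The integrating factor makes the derivative zero, so [w] keeps its value at [a]. *)
pose w u := expR (K * (u - a)) * e (x u) i 0.
have dw u : u \in `]a, s[ -> is_derive u 1 w 0.
  rewrite in_itv/= => /andP[au us].
  have u0 : 0 < u by exact: le_lt_trans au.
  have uT : (u%:E < T)%E by apply: lt_trans sT; rewrite lte_fin.
  have xu := solution_is_derive xF u0 uT.
  have dei : differentiable (fun z => e z i 0) (x u).
    apply: differentiable_entry; have -> : e = h - cst y by apply/funext.
    exact: differentiableB.
  have := is_deriveM (is_derive_expR_affine K a u) (is_derive_along dei xu).
  have -> : 'D_(F (x u)) (fun z => e z i 0) (x u) = - K * e (x u) i 0.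
    have -> : (fun z => e z i 0) = (fun z => h z i 0) - cst (y i 0).
      by apply/funext => z; rewrite /e !mxE.
    rewrite deriveB; [|exact/diff_derivable/differentiable_entry|exact: derivable_cst].
    by rewrite derive_cst subr0 -derive_entry// derive_jacobian// jacobian_flow !mxE.
  rewrite (_ : _ *: _ + _ = 0)//= /GRing.scale/=; ring.
have cw : {within `[a, s], continuous w}.
  apply: (@continuous_mul _ (subspace `[a, s])); last first.
    apply: (continuous_along xF (f := fun z => e z i 0) a0 sT) => z.
    apply: (@continuous_comp _ _ _ e (fun M : 'cV[R]_m => M i 0)); first exact: e_cts.
    exact: coord_continuous.
  apply: continuous_subspaceT => u; apply: differentiable_continuous.
  by apply/derivable1_diffP; case: (is_derive_expR_affine K a u).
rewrite [RHS]mxE; have [u us] := MVT_segment as_ dw cw.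
rewrite mul0r => /eqP; rewrite subr_eq0 {2}/w subrr mulr0 expR0 mul1r => /eqP <-.
by rewrite /w mulrA mulNr -expRD addNr expR0 mul1r.
Qed.

Let norm_e_decay T x : solution F T x -> forall a s, 0 <= a -> a <= s -> (s%:E < T)%E ->
  `|e (x s)| = expR (- K * (s - a)) * `|e (x a)|.
Proof.
move=> xF a s a0 as_ sT.
by rewrite (e_decay xF a0 as_ sT) normrZ ger0_norm// expR_ge0.
Qed.

Let V C x := rho x - rho chi + C * `|e x|.
Let Phi x := K * (c * norm2 (p x) ^+ 2 + `|e x|).

Let V_cts C : continuous (V C).
Proof.
apply: continuous_add; last first.
  by apply: continuous_mul; [exact: cst_continuous|exact: norm_e_cts].
apply: continuous_add; last exact: cst_continuous.
by move=> x; exact: differentiable_continuous.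
Qed.

Let Phi_cts : continuous Phi.
Proof.
apply: continuous_mul; first exact: cst_continuous.
apply: continuous_add => //; apply: continuous_mul; first exact: cst_continuous.
move=> x; apply: (@continuous_comp _ _ _ (fun x => norm2 (p x)) (fun t => t ^+ 2)).
  by apply: continuous_norm2; exact: p_cts.
exact: exprn_continuous.
Qed.

Let V_dissipation C r : (forall x, norm2 (x - chi) <= r -> kappa x + 1 <= C) ->
  forall T x, solution F T x -> forall a b mu,
  0 <= a -> a <= b -> (b%:E < T)%E ->
  (forall s, a <= s <= b -> norm2 (x s - chi) <= r /\ mu <= Phi (x s)) ->
  V C (x b) <= V C (x a) - mu * (b - a).
Proof.
move=> kC T x xF a d mu a0 ad dT xr.
(* The norm of [e] is not differentiable in general, but along a solution it equals a constant times
   an exponential. So [W] is differentiable inside the interval and equals [V C] plus the constant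
   [rho chi] along the solution. *)
pose W s := rho (x s) + C * `|e (x a)| * expR (- K * (s - a)).
pose dW s := 'D_(F (x s)) rho (x s) + C * `|e (x a)| * (expR (- K * (s - a)) * - K).
have dWP s : s \in `]a, d[ -> is_derive s 1 W (dW s).
  rewrite in_itv/= => /andP[as_ sd].
  have s0 : 0 < s by exact: le_lt_trans as_.
  have sT : (s%:E < T)%E by apply: lt_trans dT; rewrite lte_fin.
  have xs := solution_is_derive xF s0 sT.
  apply: (is_deriveD (is_derive_along (drho (x s)) xs)).
  exact: (is_deriveZ _ (is_derive_expR_affine (- K) a s)).
have cW : {within `[a, d], continuous W}.
  apply: (@continuous_add _ (subspace `[a, d])).
    apply: (continuous_along xF (f := rho) a0 dT) => z.
    exact: differentiable_continuous.
  apply: continuous_subspaceT => v; apply: differentiable_continuous.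
  apply: differentiableM; first exact: differentiable_cst.
  by apply/derivable1_diffP; case: (is_derive_expR_affine (- K) a v).
have [s] := MVT_segment ad dWP cW.
rewrite in_itv/= => /andP[as_ sd] Wda.
have sT : (s%:E < T)%E by apply: le_lt_trans dT; rewrite lee_fin.
(* The penalty contributes -K C |e|. As C >= kappa + 1, it absorbs K kappa |e| and leaves at most
   -Phi. *)
have dWmu : dW s <= - mu.
  have [xsr muP] := xr s (introT andP (conj as_ sd)).
  rewrite /dW mulrA -[X in _ + X * _]mulrA [`|_| * expR _]mulrC.
  rewrite -(norm_e_decay xF a0 as_ sT).
  have := derive_flow (x s); have := kC _ xsr; move: muP; rewrite /Phi.
  have : 0 <= `|e (x s)| by [].
  move: (`|e (x s)|) (norm2 (p (x s))) (kappa (x s)) ('D_(F (x s)) rho (x s)).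
  move=> E N k D E0 muP kC' DP.
  have : K * ((k + 1) * E) <= K * (C * E) by rewrite ler_pM2l// ler_wpM2r.
  lra.
have WE u : a <= u -> u <= d -> W u = V C (x u) + rho chi.
  move=> au ud; rewrite /W /V (norm_e_decay xF a0 au); last first.
    by apply: le_lt_trans dT; rewrite lee_fin.
  ring.
move: Wda; rewrite !WE// => Wda.
have : dW s * (d - a) <= - mu * (d - a) by rewrite ler_wpM2r// subr_ge0.
lra.
Qed.

(** Since H v = -e, a step l v reduces C |e| by l C |e| up to o(l), while [rho] grows by at most l
    kappa |e| + o(l). *)
Let penalty_descent C x : kappa x < C -> e x <> 0 ->
  let v := weighted_pinv (A x) (H x) *m (- e x) in
  \forall l \near 0^'+, V C (l *: v + x) < V C x.
Proof.
move=> kC e0 v.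
have C0 : 0 <= C by apply: le_trans (ltW kC); apply: sumr_ge0.
have ne0 : 0 < `|e x| by rewrite normr_gt0; apply/eqP.
have /derivable_right qrho : derivable rho x v by exact: diff_derivable.
have /derivable_right qh : derivable h x v by exact: diff_derivable.
have Dh : 'D_v h x = - e x by rewrite derive_jacobian// jacobian_pinv.
have Drho : 'D_v rho x <= kappa x * `|e x|.
  by rewrite derive_gradient// /v mulmxA -[`|e x|]normrN; exact: kappa_bound.
pose q (l : R) := l^-1 *: (h (l *: v + x) - h x).
(* Slope of [rho] plus [C] times the linearization error of [h]; descent follows once this is below
   C |e|. *)
pose g (l : R) := l^-1 *: (rho (l *: v + x) - rho x) + C * `|q l + e x|.
have g_cvg : g l @[l --> 0^'+] --> 'D_v rho x + C * `|- e x + e x|.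
  apply: cvgD; first exact: qrho.
  apply: cvgM; first exact: cvg_cst.
  apply: cvg_norm; apply: cvgD; last exact: cvg_cst.
  by rewrite -Dh; exact: qh.
have lim_lt : 'D_v rho x + C * `|- e x + e x| < C * `|e x|.
  by rewrite addNr normr0 mulr0 addr0 (le_lt_trans Drho)// ltr_pM2r.
near=> l.
have l0 : 0 < l by [].
have l1 : l <= 1 by near: l; exact: nbhs_right_le.
have gl : g l < C * `|e x| by near: l; exact: (cvgr_lt _ g_cvg).
have eE : e (l *: v + x) = (1 - l) *: e x + l *: (q l + e x).
  have -> : l *: (q l + e x) = h (l *: v + x) - h x + l *: e x.
    by rewrite [LHS]scalerDr /q scalerA divff ?gt_eqF// scale1r.
  rewrite scalerBl scale1r; move: (l *: e x) => w; apply/colP => i.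
  by rewrite /e !mxE; ring.
have en : `|e (l *: v + x)| <= (1 - l) * `|e x| + l * `|q l + e x|.
  rewrite eE (le_trans (ler_normD _ _))// !normrZ ger0_norm ?subr_ge0//.
  by rewrite (ger0_norm (ltW l0)).
have gE : l * g l = rho (l *: v + x) - rho x + l * (C * `|q l + e x|).
  by rewrite /g mulrDr /GRing.scale/= mulrA divff ?gt_eqF// mul1r.
have lg : l * g l < l * (C * `|e x|) by rewrite ltr_pM2l.
have Cen := ler_wpM2l C0 en.
rewrite /V; lra.
Unshelve. all: by end_near. Qed.

(** Every minimizer of [V C] over the closed ball is shown to be interior, then feasible, then equal
    to [chi], where [V C] is 0. *)
Let penalty_pos r : 0 < r -> h chi = y ->
  (forall x, norm2 (x - chi) <= r -> h x = y -> x <> chi -> rho chi < rho x) ->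
  exists C, (forall x, norm2 (x - chi) <= r -> kappa x + 1 <= C) /\
    (forall x, x <> chi -> norm2 (x - chi) <= r -> 0 < V C x).
Proof.
move=> r0 hchi rhomin.
have [M0 kM0] := continuous_ball_bounded chi (ltW r0) kappa_cts.
have rho_cts : continuous rho by move=> x; exact: differentiable_continuous.
have gap_cts : continuous (fun x => rho x - rho chi).
  by apply: continuous_add => //; exact: cst_continuous.
have [M1 rM1] : exists M, forall x, norm2 (x - chi) <= r -> rho chi - rho x <= M.
  apply: continuous_ball_bounded (ltW r0) _.
  apply: continuous_add; first exact: cst_continuous.
  by move=> x; apply: differentiable_continuous; exact: differentiableN.
have e0P x : (e x = 0) <-> (h x = y).
  by rewrite /e; split => [/eqP|->]; [rewrite subr_eq0 => /eqP|rewrite subrr].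
(* As |a| + a is twice the positive part of a, [f] is positive exactly where [x] is infeasible or
   costs more than [chi]. *)
pose f x := `|e x| + (`|rho x - rho chi| + (rho x - rho chi)).
have f_cts : continuous f.
  apply: continuous_add => //; apply: continuous_add => // x.
  apply: (@continuous_comp _ _ _ (fun x => rho x - rho chi) Num.norm).
    exact: gap_cts.
  exact: norm_continuous.
have fpos x : x <> chi -> norm2 (x - chi) <= r -> 0 < f x.
  move=> xchi xr; have [ex|/eqP ex] := eqVneq (e x) 0.
    have gap : rho chi < rho x by apply: rhomin => //; exact/e0P.
    by rewrite /f ex normr0 add0r ltr_wpDl// subr_gt0.
  rewrite /f ltr_pwDl// ?normr_gt0; first exact/eqP.
  by rewrite addrC -lerBlDr sub0r lerNl -normrN ler_norm.
(* With inner radius [r] the annulus is just the sphere. *)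
have [m0 m00 mf] := annulus_lower_bound f_cts r0 fpos.
have M10 : 0 <= M1 by rewrite -(subrr (rho chi)) rM1// subrr norm2_0 ltW.
(* The first bound dominates [kappa] + 1 on the ball; the second makes C m0 exceed any possible gain
   M1 in [rho]. *)
pose C := Num.max (M0 + 1) ((M1 + 1) / m0).
have kC x : norm2 (x - chi) <= r -> kappa x + 1 <= C.
  by move=> /kM0 kx; rewrite le_max lerD2r kx.
have CM : M1 < C * m0.
  have : (M1 + 1) / m0 * m0 <= C * m0 by rewrite ler_pM2r// le_max lexx orbT.
  by rewrite divfK ?gt_eqF//; apply: lt_le_trans; rewrite ltrDl.
have C0 : 0 < C.
  by rewrite lt_max [X in _ || X]divr_gt0 ?orbT// ltr_wpDl.
have V0 : V C chi = 0 by rewrite /V (e0P chi).2// subrr normr0 mulr0 addr0.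
have min_chi z : norm2 (z - chi) <= r ->
    (forall x, norm2 (x - chi) <= r -> V C z <= V C x) -> z = chi.
  move=> zr zmin.
  have Vz : V C z <= 0 by rewrite -V0; apply: zmin; rewrite subrr norm2_0 ltW.
  (* On the sphere, either [rho] exceeds [rho chi], or [f] reduces to |e| >= m0 and the penalty
     exceeds M1. Both make [V C] positive. *)
  have zr' : norm2 (z - chi) < r.
    rewrite lt_neqAle zr andbT; apply/eqP => zrE.
    have := mf z; rewrite zrE lexx => /(_ isT); rewrite /f => mz.
    have [gap|gap] := leP (rho z - rho chi) 0.
      rewrite ler0_norm// addNr addr0 in mz.
      have := rM1 z zr; have := ler_wpM2l (ltW C0) mz; rewrite /V in Vz; lra.
    by move: Vz; rewrite leNgt => /negP; apply; rewrite /V ltr_pwDl// mulr_ge0// ltW.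
  (* At an infeasible interior point, a short step along the descent direction stays in the ball and
     lowers [V C]. *)
  have ez : e z = 0.
    apply: contrapT => ez.
    have kz : kappa z < C by apply: lt_le_trans (kC z zr); rewrite ltrDl.
    have D := penalty_descent kz ez; set v := _ *m _ in D.
    have : (norm2 (l *: v + z - chi)) @[l --> 0^'+] --> norm2 (0 *: v + z - chi).
      apply: cvg_at_right_filter.
      apply: (@continuous_comp _ _ _
        (fun l : R => l *: v + z) (fun x => norm2 (x - chi))).
        apply: cvgD; last exact: cvg_cst.
        by apply: cvgZr_tmp; exact: cvg_id.
      exact: norm2_continuous.
    rewrite scale0r add0r => /cvgr_lt /(_ _ zr') N.
    have [l [Vl Nl]] := filter_ex (filterI D N).
    by move: (zmin _ (ltW Nl)); rewrite leNgt Vl.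
  apply: contrapT => zchi; move: Vz; rewrite /V ez normr0 mulr0 addr0 subr_le0 leNgt.
  by rewrite rhomin//; exact/e0P.
exists C; split => // x xchi xr.
have Bchi : [set x | norm2 (x - chi) <= r] !=set0.
  by exists chi; rewrite /= subrr norm2_0 ltW.
have [z] := compact_EVT_min Bchi (@compact_norm2_ball _ _ chi r)
  (continuous_subspaceT (@V_cts C)).
rewrite inE /= => zr zmin.
have zchi : z = chi by apply: min_chi => // t tr; apply: zmin; rewrite inE.
(* A point with V <= 0 attains the minimum 0 as well, so it is [chi]. *)
rewrite ltNge; apply/negP => Vx; apply: xchi; apply: min_chi => // t tr.
by rewrite (le_trans Vx)// -V0 -zchi zmin// inE.
Qed.

Lemma gradient_flow_asymptotically_stable :
  local_minimizers rho (equality_feasible h y) chi ->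
  (exists2 r : R, 0 < r & forall x, stationary_points rho h y x ->
     norm2 (x - chi) < r -> x = chi) ->
  asymptotically_stable F chi.
Proof.
move=> [/eqP]; rewrite subr_eq0 => /eqP hchi [D D0 rhomin] [r1 r10 iso].
(* Halving places the closed ball inside both open balls, that of minimality and that of
   isolation. *)
pose r := Num.min D r1 / 2.
have r0 : 0 < r by rewrite divr_gt0// lt_min D0.
have rD : r < D /\ r < r1.
  have : r < Num.min D r1 by rewrite /r; move: r0; rewrite /r; lra.
  by rewrite lt_min => /andP.
have [C [kC Vpos]] : exists C, (forall x, norm2 (x - chi) <= r -> kappa x + 1 <= C) /\
    (forall x, x <> chi -> norm2 (x - chi) <= r -> 0 < V C x).
  apply: penalty_pos => // x xr hx xchi; apply: rhomin => //.
    by rewrite /equality_feasible/= hx subrr.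
  by apply: le_lt_trans xr _; case: rD.
have V0 : V C chi = 0 by rewrite /V /e hchi !subrr normr0 mulr0 addr0.
have Phi_ge0 x : 0 <= Phi x.
  apply: mulr_ge0; first exact: ltW.
  by apply: addr_ge0 => //; apply: mulr_ge0; [exact: ltW|exact: sqr_ge0].
(* If [Phi] vanishes then e = 0 and p = 0, so the decomposition of the gradient makes [x]
   stationary, and isolation gives x = chi. *)
have Phi_pos x : x <> chi -> norm2 (x - chi) <= r -> 0 < Phi x.
  move=> xchi xr; rewrite lt_neqAle Phi_ge0 andbT eq_sym; apply/eqP => /eqP.
  rewrite mulf_eq0 gt_eqF//= paddr_eq0//; last first.
    by apply: mulr_ge0; [exact: ltW|exact: sqr_ge0].
  rewrite mulf_eq0 gt_eqF//= sqrf_eq0 normr_eq0 subr_eq0.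
  move=> /andP[/eqP/norm2_eq0 px /eqP hx].
  apply: xchi; apply: iso; last by apply: le_lt_trans xr _; case: rD.
  have [z rz] := projected_step_decomp (H x) c0 (@rhoc x) (gradient rho x).
  exists z; split; last by rewrite hx addNr.
  by rewrite {1}rz -/(p x) px mulmx0 add0r subrr.
have diss := V_dissipation kC.
split.
  exact: (lyapunov_stable r0 (@V_cts C) V0 Vpos (fun x _ => Phi_ge0 x) diss).
exact: (lyapunov_attractive r0 (@V_cts C) Phi_cts V0 Vpos
  (fun x _ => Phi_ge0 x) Phi_pos diss).
Qed.

End GradientFlow.

(** * Application to problem (P) at a fixed instant *)

Theorem lemma8 (R : realType) (dx dy dc : nat)
  (sigma : R -> 'cV[R]_dx -> R)
  (Y : set 'cV[R]_dy) (h : R -> 'cV[R]_dx -> 'cV[R]_dy) (yref : R -> 'cV[R]_dy)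
  (G : R -> 'M[R]_(dc, dx)) (c : R -> 'cV[R]_dc)
  (beta : R -> R) (Kx : R) :
  let g := fun t => affine_map (G t) (c t) in
  let rho := fun t => augmented_cost beta (g t) (sigma t) in
  let minimizers_P := fun t =>
    local_minimizers (sigma t) (feasible (h t) (yref t) (g t)) in
  (* h *)
  (forall x, {within [set t : R | 0 <= t], continuous (fun t => h t x)}) ->
  (forall t, 0 <= t -> C2 (h t)) ->
  (forall t, 0 <= t -> range (h t) = Y) ->
  (forall t x, 0 <= t -> row_free (jacobian_mx (h t) x)) ->
  (* A1 *)
  (forall t, 0 <= t -> C2 (sigma t) /\ strongly_convex (sigma t)) ->
  (* A2 *)
  (forall t, 0 <= t -> exists chi, minimizers_P t chi) ->
  (* A3 *)
  (forall t, 0 <= t -> minimizers_P t `<=` isolated (minimizers_P t)) ->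
  (* A4 *)
  (exists chis : R -> 'cV[R]_dx,
     (forall t, 0 <= t ->
        exists l, derivative_within [set u : R | 0 <= u] chis t l) /\
     (forall t, 0 <= t -> minimizers_P t (chis t))) ->
  barrier G c beta ->
  (* identification of the minimizers of (P), of the minimizers of the
     augmented problem and of the roots of the stationarity equations *)
  (forall t, 0 <= t ->
     minimizers_P t
       = local_minimizers (rho t) (equality_feasible (h t) (yref t)) /\
     minimizers_P t = stationary_points (rho t) (h t) (yref t)) ->
  0 < Kx ->
  forall t, 0 <= t -> forall chi, minimizers_P t chi ->
    let F := fun x => Kx *: eta (rho t) (h t) x (yref t) in
    equilibrium F chi /\ asymptotically_stable F chi.
Proof.
move=> g rho minP _ h2 _ rfH sig2 _ iso _ [beta2 _ _ beta_sc] ident K0 t t0 chi chiP F.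
have [minE statE] := ident t t0.
have [s2 ssc] := sig2 t t0.
have rho2 : C2 (rho t) by exact: C2_augmented_cost.
have [k k0 rhosc] : strongly_convex (rho t) by exact: beta_sc.
have rhoc x : coercive_mx (jacobian_mx (gradient (rho t)) x) k.
  exact: hessian_coercive.
have [h1 _] := h2 t t0.
have rfHt x : row_free (jacobian_mx (h t) x) by exact: rfH.
split.
  by apply: (stationary_equilibrium _ k0 rhoc rfHt); rewrite -statE.
apply: (gradient_flow_asymptotically_stable K0 k0 rho2 h1 rhoc rfHt).
  by rewrite -minE.
(* Through the identification, isolation of the minimizers of (P) becomes isolation of the
   stationary points. *)
have [_ [U /nbhs_norm2[r r0 rU] UE]] := iso t t0 _ chiP.
exists r => // x xstat xr.
have : (U `&` minP t) x by split; [exact: rU|rewrite statE].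
by rewrite UE.
Qed.
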